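(* Let $A\in\mathbb{R}^{n\times d}$ have i.i.d. rows with mean zero and covariance $\Sigma$, $b\in\mathbb{R}^n$, and $A$ split row-wise into $m$ blocks $A^{(i)}\in\mathbb{R}^{(n/m)\times d}$. Let $f(x)=\frac1{2n}\|Ax-b\|_2^2+\frac\lambda2\|x\|_2^2$ ($\lambda>0$), $g=\nabla f$, $H=\frac1nA^TA+\lambda I$, $d_\lambda=\mathrm{tr}(\Sigma(\Sigma+\lambda I)^{-1})$ with $md_\lambda<n$, and $\tilde H=\left(\frac1m\sum_{i=1}^m\left(\frac{1}{1-\frac{md_\lambda}{n}}\frac mnA^{(i)T}A^{(i)}+\lambda I\right)^{-1}\right)^{-1}$. Let $\omega^\star=\arg\min f$ and $\omega_{t+1}=\omega_t-\tilde p_t$, where $\tilde p_t$ is the output of $s_t$ iterations of the preconditioned conjugate gradient method applied to the linear system $Hp=g(\omega_t)$ with preconditioner $\tilde H^{-1}$ and initial point $0$; set $\Delta_t=\omega_t-\omega^\star$. Let $\alpha_0=\|\Sigma-\frac1nA^TA\|$, $\alpha_1=\|\tilde H^{-1}-\mathbb{E}[\tilde H^{-1}]\|$, $\Omega_0=\mathbb{E}[\tilde H^{-1}]-(\Sigma+\lambda I)^{-1}$, $\alpha=(\sigma_{\max}+\lambda+\alpha_0)(\frac1{\lambda^2}\alpha_0+\alpha_1+\|\Omega_0\|)$, with $\sigma_{\min},\sigma_{\max}$ the extreme eigenvalues of $\Sigma$. Then \[\|\Delta_{t+1}\|\le\frac{\sqrt2\alpha'}{\sqrt{1-\alpha'^2}}\sqrt{\frac{\sigma_{\max}+\lambda+\alpha_0}{\sigma_{\min}+\lambda-\alpha_0}}\|\Delta_t\|,\qquad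 \alpha'=\sqrt{4\left(\frac{1-\sqrt{1-\frac{\alpha}{1-\alpha}}}{1+\sqrt{1-\frac{\alpha}{1-\alpha}}}\right)^{s_t}}.\]
   Context: $\|\cdot\|$ is the Euclidean norm on vectors and the spectral norm on matrices; $n/m$ is an integer.
   Formalization: Assumes additionally α < 1/2, α' < 1 and α_0 < σ_min + λ, without which the square roots and quotients in the bound are undefined (or, for α > 1 and even s_t, the bound can fail). *)

(* Defs.v *)
From HB Require Import structures.
From mathcomp Require Import all_boot all_order all_algebra.
From mathcomp Require Import all_classical all_reals all_analysis.
From mathcomp Require Import zify.
Set Implicit Arguments. Unset Strict Implicit. Unset Printing Implicit Defensive.
Import Order.TTheory GRing.Theory Num.Theory.
Local Open Scope ring_scope.

Section Defs.
Variable R : realType.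

Definition enorm (k : nat) (v : 'cV[R]_k) : R := Num.sqrt (\sum_(i < k) v i 0 ^+ 2).

Definition specnorm (p q : nat) (M : 'M[R]_(p, q)) : R :=
  sup [set enorm (M *m x) | x in [set x : 'cV[R]_q | enorm x <= 1]]%classic.

Definition fobj (n d : nat) (A : 'M[R]_(n, d)) (b : 'cV[R]_n) (lam : R) (x : 'cV[R]_d) : R :=
  (2 * n%:R)^-1 * enorm (A *m x - b) ^+ 2 + lam / 2 * enorm x ^+ 2.

Definition Hmat (n d : nat) (A : 'M[R]_(n, d)) (lam : R) : 'M[R]_d :=
  n%:R^-1 *: (A^T *m A) + lam%:M.

Definition dlam (d : nat) (Sigma : 'M[R]_d) (lam : R) : R :=
  \tr (Sigma *m invmx (Sigma + lam%:M)).

End Defs.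

Lemma blk_proof (n m : nat) (i : 'I_m) (r : 'I_(n %/ m)) : (i * (n %/ m) + r < n)%N.
Proof.
have hi := ltn_ord i; have hr := ltn_ord r.
have h1 : (i * (n %/ m) + r < i.+1 * (n %/ m))%N by rewrite mulSn addnC ltn_add2r.
apply: (leq_trans h1); apply: (@leq_trans (m * (n %/ m))%N).
  by rewrite leq_mul2r hi orbT.
by rewrite mulnC leq_trunc_div.
Qed.

Definition blk_idx (n m : nat) (i : 'I_m) (r : 'I_(n %/ m)) : 'I_n :=
  Ordinal (blk_proof i r).

Section Defs2.
Variable R : realType.

Definition Ablock (n d m : nat) (A : 'M[R]_(n, d)) (i : 'I_m) : 'M[R]_(n %/ m, d) :=
  \matrix_(r < n %/ m, j < d) A (blk_idx i r) j.

Definition Htilde (n d m : nat) (A : 'M[R]_(n, d)) (lam dl : R) : 'M[R]_d :=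
  invmx (m%:R^-1 *: \sum_(i < m)
    invmx ((1 - m%:R * dl / n%:R)^-1 * (m%:R / n%:R) *:
             ((Ablock A i)^T *m Ablock A i) + lam%:M)).

Definition pcg_step (d : nat) (H Pc : 'M[R]_d)
  (st : 'cV[R]_d * 'cV[R]_d * 'cV[R]_d) : 'cV[R]_d * 'cV[R]_d * 'cV[R]_d :=
  let: (x, r, p) := st in
  let z := Pc *m r in
  let a := (r^T *m z) 0 0 / (p^T *m H *m p) 0 0 in
  let x' := x + a *: p in
  let r' := r - a *: (H *m p) in
  let z' := Pc *m r' in
  let beta := (r'^T *m z') 0 0 / (r^T *m z) 0 0 in
  (x', r', z' + beta *: p).

Definition pcg (d : nat) (H Pc : 'M[R]_d) (rhs : 'cV[R]_d) (s : nat) : 'cV[R]_d :=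
  (iter s (pcg_step H Pc) (0, rhs, Pc *m rhs)).1.1.

End Defs2.

Local Open Scope classical_set_scope.
Local Open Scope ereal_scope.

(* The rows of the random matrix X : T -> 'M_(n,d) are i.i.d. random vectors:
   entries are measurable, the rows are mutually independent and identically
   distributed (laws compared on the generating pi-system of measurable
   rectangles of R^d). *)
Definition iid_rows (dsp : measure_display) (T : measurableType dsp) (R : realType)
  (P : probability T R) (n d : nat) (X : T -> 'M[R]_(n, d)) : Prop :=
  [/\ (forall i j, measurable_fun setT (fun w => X w i j)),
      (forall B : 'I_n -> 'I_d -> set R, (forall i j, measurable (B i j)) ->
         P [set w | forall i j, B i j (X w i j)]
         = \prod_(i < n) P [set w | forall j, B i j (X w i j)]) &
      (forall (i i' : 'I_n) (B : 'I_d -> set R), (forall j, measurable (B j)) ->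
         P [set w | forall j, B j (X w i j)] = P [set w | forall j, B j (X w i' j)])].

(* Main.v *)
(* Put E = Htilde^-1 - H^-1 and L = smax + lam + alpha0. Comparing both inverses
   with (Sigma + lam)^-1 gives ||E|| <= alpha / L, and ||H|| <= L, so the
   stationary update e |-> e - Htilde^-1 H e contracts the energy norm by the
   factor alpha. A step of preconditioned conjugate gradients does at least as
   well as the stationary update, hence s steps contract by alpha^s. Since
   alpha^2 <= (1 - q) / (1 + q), already this crude factor is below alpha', and
   no Chebyshev polynomial is needed; passing from the energy norm to the
   Euclidean one costs the square root of the condition number of H. *)
Require Import Defs.
From HB Require Import structures.
From mathcomp Require Import all_boot all_order all_algebra.
From mathcomp Require Import all_classical all_reals all_analysis.
From mathcomp Require Import ring lra.
Import Order.TTheory GRing.Theory Num.Theory.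
Local Open Scope ring_scope.

(** * Inner products, positive definite matrices and Cauchy-Schwarz *)

Section QuadraticForms.
Context {F : realFieldType} {k : nat}.
Implicit Types (x y z : 'cV[F]_k) (M : 'M[F]_k) (a c : F).

Definition dot x y : F := (x^T *m y) 0 0.

Lemma dotE x y : dot x y = \sum_i x i 0 * y i 0.
Proof. by rewrite /dot mxE; apply: eq_bigr => i _; rewrite mxE. Qed.

Lemma dotC x y : dot x y = dot y x.
Proof. by rewrite !dotE; apply: eq_bigr => i _; rewrite mulrC. Qed.

Lemma dotDl x y z : dot (x + y) z = dot x z + dot y z.
Proof. by rewrite /dot linearD mulmxDl mxE. Qed.

Lemma dotDr x y z : dot x (y + z) = dot x y + dot x z.
Proof. by rewrite /dot mulmxDr mxE. Qed.

Lemma dotNl x y : dot (- x) y = - dot x y.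
Proof. by rewrite /dot linearN mulNmx mxE. Qed.

Lemma dotNr x y : dot x (- y) = - dot x y.
Proof. by rewrite /dot mulmxN mxE. Qed.

Lemma dotZl a x y : dot (a *: x) y = a * dot x y.
Proof. by rewrite /dot linearZ -scalemxAl mxE. Qed.

Lemma dotZr a x y : dot x (a *: y) = a * dot x y.
Proof. by rewrite /dot -scalemxAr mxE. Qed.

Lemma dot0l x : dot 0 x = 0.
Proof. by rewrite /dot trmx0 mul0mx mxE. Qed.

Lemma dot0r x : dot x 0 = 0.
Proof. by rewrite dotC dot0l. Qed.

Lemma dot_sumr (I : Type) (s : seq I) (f : I -> 'cV[F]_k) x :
  dot x (\sum_(i <- s) f i) = \sum_(i <- s) dot x (f i).
Proof. by rewrite /dot mulmx_sumr summxE. Qed.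

Lemma dot_ge0 x : 0 <= dot x x.
Proof. by rewrite dotE; apply: sumr_ge0 => i _; rewrite -expr2 sqr_ge0. Qed.

Lemma dot_eq0 x : (dot x x == 0) = (x == 0).
Proof.
apply/eqP/eqP => [|->]; last by rewrite dot0l.
rewrite dotE => /psumr_eq0P h; apply/colP => i; rewrite mxE.
have /eqP := h (fun i _ => sqr_ge0 (x i 0)) i isT.
by rewrite mulf_eq0 orbb => /eqP.
Qed.

Lemma dot_gt0 x : x != 0 -> 0 < dot x x.
Proof. by move=> x0; rewrite lt_neqAle dot_ge0 andbT eq_sym dot_eq0. Qed.

Lemma sym_dot M x y : M^T = M -> dot x (M *m y) = dot (M *m x) y.
Proof. by move=> hM; rewrite /dot trmx_mul hM mulmxA. Qed.

(** The form at [x + t *: y] is a nonnegative polynomial of degree at most 2 in [t]; evaluating it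
    at its minimiser [- b / c] gives the bound. *)
Lemma psd_cauchy_schwarz M x y : M^T = M -> (forall z, 0 <= dot z (M *m z)) ->
  dot x (M *m y) ^+ 2 <= dot x (M *m x) * dot y (M *m y).
Proof.
move=> hM psd.
have hxy : dot y (M *m x) = dot x (M *m y) by rewrite sym_dot // dotC.
have q t : 0 <= dot x (M *m x) + 2 * t * dot x (M *m y) + t ^+ 2 * dot y (M *m y).
  have := psd (x + t *: y).
  rewrite mulmxDr -scalemxAr !dotDl !dotDr !dotZl !dotZr hxy; lra.
move: q (psd x) (psd y).
move: (dot x (M *m x)) (dot x (M *m y)) (dot y (M *m y)) => a b c q a0 c0.
have [c00|c00] := eqVneq c 0.
  have [->|b0] := eqVneq b 0; first by rewrite expr0n /= c00 mulr0.
  (* With [c = 0] and [b != 0] the polynomial is affine, and this [t] would give it the value -1. *)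
  have := q (- (a + 1) / (2 * b)); rewrite c00 mulr0 addr0.
  have -> : 2 * (- (a + 1) / (2 * b)) * b = - (a + 1) by field.
  by lra.
have {c00} c1 : 0 < c by rewrite lt_neqAle eq_sym c00.
have := q (- b / c).
have -> : a + 2 * (- b / c) * b + (- b / c) ^+ 2 * c = (a * c - b ^+ 2) / c.
  by field; rewrite gt_eqF.
by rewrite pmulr_lge0 ?invr_gt0 // subr_ge0.
Qed.

Lemma cauchy_schwarz x y : dot x y ^+ 2 <= dot x x * dot y y.
Proof.
have := @psd_cauchy_schwarz 1%:M x y; rewrite !mul1mx trmx1; apply => // z.
by rewrite mul1mx dot_ge0.
Qed.

Definition posdef M := M^T = M /\ forall x, x != 0 -> 0 < dot x (M *m x).

Lemma posdef_ge0 M x : posdef M -> 0 <= dot x (M *m x).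
Proof.
move=> [_ h]; have [->|x0] := eqVneq x 0; first by rewrite dot0l.
exact/ltW/h.
Qed.

Lemma posdef_eq0 M x : posdef M -> dot x (M *m x) = 0 -> x = 0.
Proof.
move=> [_ h] h0; apply/eqP/negPn/negP => /h; by rewrite h0 ltxx.
Qed.

Lemma posdef_unit M : posdef M -> M \in unitmx.
Proof.
move=> [hM pd]; rewrite unitmxE unitfE; apply/negP => /det0P [v v0 hv].
have /pd : v^T != 0 by rewrite -(inj_eq (can_inj (@trmxK _ _ _))) trmxK trmx0.
by rewrite /dot trmxK mulmxA hv mul0mx mxE ltxx.
Qed.

(** The substitution [x = M *m y] turns the form of [invmx M] into that of [M]. *)
Lemma posdef_inv M : posdef M -> posdef (invmx M).
Proof.
move=> pM; have uM := posdef_unit M pM; have [hM pd] := pM.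
have hI : (invmx M)^T = invmx M by rewrite trmx_inv hM.
split=> // x x0.
have y0 : invmx M *m x != 0.
  by apply: contra_neq x0 => h; rewrite -(mulKVmx uM x) h mulmx0.
by have := pd _ y0; rewrite mulKVmx // dotC.
Qed.

Lemma posdef_lb {M c} : M^T = M -> 0 < c ->
  (forall x, c * dot x x <= dot x (M *m x)) -> posdef M.
Proof.
move=> hM c0 h; split=> // x x0; apply: lt_le_trans (h x).
by rewrite mulr_gt0 ?dot_gt0.
Qed.

Lemma dot_scalar a x y : dot x (a%:M *m y) = a * dot x y.
Proof. by rewrite mul_scalar_mx dotZr. Qed.

End QuadraticForms.

Lemma dot_gram {F : realFieldType} {p k : nat} (B : 'M[F]_(p, k)) (x y : 'cV[F]_k) :
  dot x (B^T *m B *m y) = dot (B *m x) (B *m y).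
Proof. by rewrite /dot trmx_mul !mulmxA. Qed.

(** * Preconditioned conjugate gradients against the stationary iteration *)

Section ConjugateGradient.
Context {R : realType} {d : nat}.
Variables (H Pc : 'M[R]_d).
Hypotheses (pH : posdef H) (pPc : posdef Pc).
Implicit Types (u x r p : 'cV[R]_d).

(* [pp] stands for the search direction preceding [p]. *)
Definition pcg_inv u (st : 'cV[R]_d * 'cV[R]_d * 'cV[R]_d) : Prop :=
  let: (x, r, p) := st in
  r = H *m (u - x) /\
  exists (pp : 'cV[R]_d) (beta : R),
    [/\ p = Pc *m r + beta *: pp, dot r pp = 0 & dot p (H *m pp) = 0].

Lemma pcg_inv_init u : pcg_inv u (0, H *m u, Pc *m (H *m u)).
Proof.
split; first by rewrite subr0.
by exists 0, 0; rewrite scaler0 addr0 mulmx0 !dot0r.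
Qed.

Lemma pcg_stepE x r p : pcg_step H Pc (x, r, p) =
  let a := dot r (Pc *m r) / dot p (H *m p) in
  let r' := r - a *: (H *m p) in
  (x + a *: p, r',
   Pc *m r' + (dot r' (Pc *m r') / dot r (Pc *m r)) *: p).
Proof. by rewrite /pcg_step /dot !mulmxA. Qed.

(** Here [p] is a multiple of [pp] and conjugate to it, so its own energy is zero. *)
Lemma pcg_inv_residual0 u x p : pcg_inv u (x, 0, p) -> p = 0.
Proof.
move=> [_ [pp [beta [hp _ pHpp]]]].
apply: (posdef_eq0 _ _ pH); rewrite {2}hp mulmx0 add0r -scalemxAr dotZr pHpp.
by rewrite mulr0.
Qed.

Lemma pcg_inv_step u st : pcg_inv u st -> pcg_inv u (pcg_step H Pc st).
Proof.
case: st => [[x r] p] inv; have [hr [pp [beta [hp rpp pHpp]]]] := inv.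
have [hH _] := pH; have [hPc _] := pPc.
rewrite pcg_stepE /=; set a := _ / _; set r' := r - _.
split.
  by rewrite opprD addrA mulmxBr -hr -scalemxAr.
(* A zero residual forces [p = 0], so the quotients with zero denominator only scale zero
   vectors. *)
have [r0|r0] := eqVneq r 0.
  have p0 : p = 0 by move: inv; rewrite r0; apply: pcg_inv_residual0.
  exists 0, 0; rewrite p0 !scaler0 mulmx0 !dot0r.
  by split.
exists p, (dot r' (Pc *m r') / dot r (Pc *m r)).
have rz0 : dot r (Pc *m r) != 0 by rewrite gt_eqF // pPc.2.
have rp : dot r p = dot r (Pc *m r) by rewrite hp dotDr dotZr rpp mulr0 addr0.
have p0 : p != 0 by apply: contra_neq rz0 => p0; rewrite -rp p0 dot0r.
have php : dot p (H *m p) != 0 by rewrite gt_eqF // pH.2.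
have r'p : dot r' p = 0.
  by rewrite /r' dotDl dotNl dotZl rp [dot (H *m p) p]dotC /a divfK // subrr.
have a0 : a != 0 by rewrite mulf_neq0 ?invr_eq0.
(* [Pc *m r] is a combination of [p] and [pp], and [r'] is orthogonal to both. *)
have r'z : dot (Pc *m r') r = 0.
  rewrite -sym_dot //.
  have -> : Pc *m r = p - beta *: pp by rewrite hp addrK.
  rewrite dotDr dotNr dotZr r'p /r' dotDl rpp dotNl dotZl -sym_dot //.
  by rewrite pHpp; ring.
have hHp : a *: (H *m p) = r - r' by rewrite /r' opprB addrC subrK.
split=> //.
(* Scaling by [a] replaces [H *m p] by [r - r'], so conjugacy reduces to the orthogonality relations
   above and the choice of the new coefficient. *)
apply: (mulfI a0); rewrite mulr0 -dotZr hHp dotDl.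
rewrite [dot (Pc *m r') _]dotDr dotNr r'z [dot (Pc *m r') r']dotC.
rewrite dotZl dotDr dotNr [dot p r]dotC rp [dot p r']dotC r'p.
by rewrite subr0 divfK // sub0r addNr.
Qed.

(* The step length minimises the energy error along [p]; conjugacy makes [pp]
   irrelevant, so the step also beats the stationary update by [Pc *m r]. *)
Lemma pcg_step_le u x r p : pcg_inv u (x, r, p) ->
  let e := u - x in
  let e' := u - (pcg_step H Pc (x, r, p)).1.1 in
  let y := e - Pc *m (H *m e) in
  dot e' (H *m e') <= dot y (H *m y).
Proof.
move=> inv; have [hr [pp [beta [hp rpp pHpp]]]] := inv.
have [hH _] := pH.
rewrite pcg_stepE /= -hr; set a := _ / _.
rewrite opprD addrA.
move: (u - x) hr => e hr.
have [r0|r0] := eqVneq r 0.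
  have p0 : p = 0 by move: inv; rewrite r0; apply: pcg_inv_residual0.
  by rewrite p0 r0 mulmx0 scaler0.
have rz0 : dot r (Pc *m r) != 0 by rewrite gt_eqF // pPc.2.
have rp : dot r p = dot r (Pc *m r) by rewrite hp dotDr dotZr rpp mulr0 addr0.
have p0 : p != 0 by apply: contra_neq rz0 => p0; rewrite -rp p0 dot0r.
have php : 0 < dot p (H *m p) by rewrite pH.2.
have -> : Pc *m r = p - beta *: pp by rewrite hp addrK.
have eHp : dot e (H *m p) = a * dot p (H *m p).
  by rewrite sym_dot // -hr rp /a divfK // gt_eqF.
have pHe : dot p (H *m e) = a * dot p (H *m p).
  by rewrite -hr dotC rp /a divfK // gt_eqF.
have eHpp : dot e (H *m pp) = 0 by rewrite sym_dot // -hr.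
have ppHe : dot pp (H *m e) = 0 by rewrite -hr dotC.
have ppHp : dot pp (H *m p) = 0 by rewrite sym_dot // dotC.
have pos := posdef_ge0 _ (beta *: pp) pH.
rewrite -scalemxAr dotZl dotZr in pos.
rewrite opprB !(mulmxDr, mulmxN) -!scalemxAr.
rewrite !(dotDl, dotDr, dotNl, dotNr, dotZl, dotZr, mulmxN).
rewrite eHp pHe eHpp ppHe ppHp pHpp.
(* The right side exceeds the left by [(a - 1) ^+ 2 * dot p (H *m p)] plus the energy of
   [beta *: pp]. *)
have := mulr_ge0 (sqr_ge0 (a - 1)) (ltW php); nra.
Qed.

(** Each step is compared with one stationary update restarted from the current iterate, so the
    factor [c] accumulates. *)
Lemma pcg_contraction (c : R) u s : 0 <= c ->
  (forall e, let y := e - Pc *m (H *m e) in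
     dot y (H *m y) <= c * dot e (H *m e)) ->
  let e := u - pcg H Pc (H *m u) s in
  dot e (H *m e) <= c ^+ s * dot u (H *m u).
Proof.
move=> c0 hc; rewrite /= /pcg; set st0 := (0, _, _).
have inv t : pcg_inv u (iter t (pcg_step H Pc) st0).
  elim: t => [|t IH]; [exact: pcg_inv_init | exact: pcg_inv_step].
elim: s => [|s IH]; first by rewrite /= subr0 expr0 mul1r.
rewrite iterS; move: (inv s) IH; case: (iter s _ _) => [[x r] p] invs /= IH.
apply: le_trans (pcg_step_le _ _ _ _ invs) _.
apply: le_trans (hc _) _.
by rewrite exprS -mulrA ler_wpM2l.
Qed.

End ConjugateGradient.

(** * Euclidean and spectral norms, perturbed inverses, Rayleigh quotients *)

Section Norms.
Context {R : realType}.

Lemma enorm_sqr {k} (x : 'cV[R]_k) : enorm x ^+ 2 = dot x x.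
Proof.
rewrite sqr_sqrtr; last by apply: sumr_ge0 => i _; rewrite sqr_ge0.
by rewrite dotE; apply: eq_bigr => i _; rewrite expr2.
Qed.

Lemma enorm_ge0 {k} (x : 'cV[R]_k) : 0 <= enorm x.
Proof. exact: sqrtr_ge0. Qed.

Lemma enorm_le {k p} (x : 'cV[R]_k) (y : 'cV[R]_p) c : 0 <= c ->
  dot x x <= c ^+ 2 * dot y y -> enorm x <= c * enorm y.
Proof.
move=> c0; rewrite -!enorm_sqr -exprMn ler_pXn2r ?nnegrE ?mulr_ge0 //;
  exact: enorm_ge0.
Qed.

Lemma enorm_eq0 {k} (x : 'cV[R]_k) : (enorm x == 0) = (x == 0).
Proof. by rewrite -dot_eq0 -enorm_sqr sqrf_eq0. Qed.

Lemma enorm0 {k} : enorm (0 : 'cV[R]_k) = 0.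
Proof. by apply/eqP; rewrite enorm_eq0. Qed.

Lemma enormN {k} (x : 'cV[R]_k) : enorm (- x) = enorm x.
Proof. by rewrite /enorm; congr Num.sqrt; apply: eq_bigr => i _; rewrite mxE sqrrN. Qed.

Lemma enormZ {k} a (x : 'cV[R]_k) : enorm (a *: x) = `|a| * enorm x.
Proof.
apply/eqP; rewrite -(@eqrXn2 _ 2) ?mulr_ge0 ?enorm_ge0 ?normr_ge0 //.
by rewrite exprMn !enorm_sqr dotZl dotZr mulrA real_normK ?num_real.
Qed.

Lemma dot_le_enorm {k} (x y : 'cV[R]_k) : dot x y <= enorm x * enorm y.
Proof.
apply: le_trans (ler_norm _) _.
rewrite -(@ler_pXn2r _ 2) ?nnegrE ?mulr_ge0 ?enorm_ge0 ?normr_ge0 //.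
by rewrite real_normK ?num_real // exprMn !enorm_sqr cauchy_schwarz.
Qed.

Lemma enormD {k} (x y : 'cV[R]_k) : enorm (x + y) <= enorm x + enorm y.
Proof.
rewrite -(@ler_pXn2r _ 2) ?nnegrE ?addr_ge0 ?enorm_ge0 //.
rewrite sqrrD !enorm_sqr !dotDl !dotDr [dot y x]dotC.
have := dot_le_enorm x y; lra.
Qed.

(** The Frobenius norm is a bound, by Cauchy-Schwarz on each row; this makes the supremum in
    [specnorm] a genuine one. *)
Lemma enorm_mulmx_bounded {p k} (M : 'M[R]_(p, k)) :
  exists c, forall x, enorm x <= 1 -> enorm (M *m x) <= c.
Proof.
exists (Num.sqrt (\sum_i dot (row i M)^T (row i M)^T)) => x x1.
rewrite ler_wsqrtr //; apply: ler_sum => i _.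
have -> : (M *m x) i 0 = dot (row i M)^T x.
  by rewrite /dot trmxK -row_mul [RHS]mxE.
apply: le_trans (cauchy_schwarz _ _) _.
by rewrite ler_piMr ?dot_ge0 // -enorm_sqr expr_le1 ?enorm_ge0.
Qed.

Lemma specnorm_ge {p k} (M : 'M[R]_(p, k)) x :
  enorm x <= 1 -> enorm (M *m x) <= specnorm M.
Proof.
move=> x1; apply: ub_le_sup; last by exists x.
have [c hc] := enorm_mulmx_bounded M.
by exists c => _ [y y1 <-]; apply: hc.
Qed.

Lemma specnorm_ge0 {p k} (M : 'M[R]_(p, k)) : 0 <= specnorm M.
Proof.
have := @specnorm_ge p k M 0.
by rewrite mulmx0 !enorm0; apply; rewrite ler01.
Qed.

Lemma enorm_mulmx {p k} (M : 'M[R]_(p, k)) x :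
  enorm (M *m x) <= specnorm M * enorm x.
Proof.
have [->|x0] := eqVneq x 0; first by rewrite mulmx0 !enorm0 mulr0.
have n0 : 0 < enorm x by rewrite lt_neqAle enorm_ge0 eq_sym enorm_eq0 x0.
have := @specnorm_ge p k M ((enorm x)^-1 *: x).
rewrite -scalemxAr !enormZ ger0_norm ?invr_ge0 ?enorm_ge0 //.
by rewrite mulVf ?gt_eqF // lexx ler_pdivrMl // mulrC; apply.
Qed.

Lemma dot_mulmx_le {k} (M : 'M[R]_k) x : dot x (M *m x) <= specnorm M * dot x x.
Proof.
apply: le_trans (dot_le_enorm _ _) _.
rewrite -enorm_sqr expr2 mulrA [leRHS]mulrC ler_wpM2l ?enorm_ge0 //.
exact: enorm_mulmx.
Qed.

Lemma dot_mulmx_ge {k} (M : 'M[R]_k) x : - (specnorm M * dot x x) <= dot x (M *m x).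
Proof.
rewrite lerNl -dotNl; apply: le_trans (dot_le_enorm _ _) _.
rewrite enormN -enorm_sqr expr2 mulrA [leRHS]mulrC ler_wpM2l ?enorm_ge0 //.
exact: enorm_mulmx.
Qed.

(** For [y = invmx M *m x], coercivity gives [c * dot y y <= dot y x]; Cauchy-Schwarz then lets one
    factor [enorm y] cancel. *)
Lemma enorm_invmx {k} (M : 'M[R]_k) c x : M^T = M -> 0 < c ->
  (forall z, c * dot z z <= dot z (M *m z)) ->
  enorm (invmx M *m x) <= c^-1 * enorm x.
Proof.
move=> hM c0 hc; have uM := posdef_unit _ (posdef_lb hM c0 hc).
set y := invmx M *m x.
have hx : x = M *m y by rewrite mulKVmx.
rewrite ler_pdivlMl //.
have [y0|y0] := eqVneq y 0; first by rewrite y0 enorm0 mulr0 enorm_ge0.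
have n0 : 0 < enorm y by rewrite lt_neqAle enorm_ge0 eq_sym enorm_eq0 y0.
rewrite -(ler_pM2l n0) mulrCA -expr2 enorm_sqr.
by apply: le_trans (hc _) _; rewrite -hx dot_le_enorm.
Qed.

(** The resolvent identity writes the difference as [invmx M *m (N - M) *m invmx N], and each
    inverse costs [c^-1]. *)
Lemma enorm_invmxB {k} (M N : 'M[R]_k) c x : 0 < c -> M^T = M -> N^T = N ->
  (forall z, c * dot z z <= dot z (M *m z)) ->
  (forall z, c * dot z z <= dot z (N *m z)) ->
  enorm (invmx M *m x - invmx N *m x) <= specnorm (N - M) / c ^+ 2 * enorm x.
Proof.
move=> c0 hM hN cM cN.
have uM := posdef_unit _ (posdef_lb hM c0 cM).
have uN := posdef_unit _ (posdef_lb hN c0 cN).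
have -> : invmx M *m x - invmx N *m x = invmx M *m ((N - M) *m (invmx N *m x)).
  by rewrite mulmxBl mulKVmx // mulmxBr mulKmx.
apply: le_trans (enorm_invmx M c _ hM c0 cM) _.
have -> : specnorm (N - M) / c ^+ 2 * enorm x =
    c^-1 * (specnorm (N - M) * (c^-1 * enorm x)) by rewrite expr2 invfM; ring.
apply: ler_wpM2l; first by rewrite invr_ge0 ltW.
apply: le_trans (enorm_mulmx _ _) _; apply: ler_wpM2l; first exact: specnorm_ge0.
exact: enorm_invmx.
Qed.

(* For [s] the supremum of the Rayleigh quotient, [s%:M - S] is positive
   semidefinite; were it invertible, Cauchy-Schwarz for its form would bound it
   away from 0 on the sphere. So [s] is an eigenvalue. *)
Lemma rayleigh_le {k} (S : 'M[R]_k) c x : S^T = S ->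
  (forall a, eigenvalue S a -> a <= c) -> dot x (S *m x) <= c * dot x x.
Proof.
move=> hS hc; have [->|x0] := eqVneq x 0; first by rewrite !dot0l mulr0.
pose A := [set dot y (S *m y) | y in [set y : 'cV[R]_k | dot y y = 1]]%classic.
pose s := sup A.
have unit_norm (y : 'cV[R]_k) : y != 0 ->
    dot ((enorm y)^-1 *: y) ((enorm y)^-1 *: y) = 1.
  move=> y0; rewrite dotZl dotZr -enorm_sqr.
  by field; rewrite enorm_eq0.
have A0 : (A !=set0)%classic.
  by eexists; exists ((enorm x)^-1 *: x) => //; exact: unit_norm.
have ubA : has_ubound A.
  exists (specnorm S) => _ [y y1 <-].
  by apply: le_trans (dot_mulmx_le _ _) _; rewrite y1 mulr1.
have hs y : dot y (S *m y) <= s * dot y y.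
  have [->|y0] := eqVneq y 0; first by rewrite !dot0l mulr0.
  have n0 : 0 < dot y y by exact: dot_gt0.
  have : dot ((enorm y)^-1 *: y) (S *m ((enorm y)^-1 *: y)) <= s.
    by apply: ub_le_sup => //; eexists => //; exact: unit_norm.
  rewrite -scalemxAr dotZl dotZr mulrA -invfM -expr2 enorm_sqr.
  by rewrite ler_pdivrMl // mulrC.
suff es : eigenvalue S s.
  by apply: le_trans (hs x) _; rewrite ler_wpM2r ?dot_ge0 ?hc.
pose M := s%:M - S.
have hM : M^T = M by rewrite /M linearB /= tr_scalar_mx hS.
have MS y : dot y (M *m y) = s * dot y y - dot y (S *m y).
  by rewrite /M mulmxBl dotDr dotNr dot_scalar.
have psdM y : 0 <= dot y (M *m y) by rewrite MS subr_ge0.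
have [uM|nuM] := boolP (M \in unitmx); last first.
  move: nuM; rewrite unitmxE unitfE negbK => /det0P [v v0 hv].
  apply/eigenvalueP; exists v => //.
  by move/eqP: hv; rewrite /M mulmxBr mul_mx_scalar subr_eq0 => /eqP.
(* Cauchy-Schwarz for [y] and [invmx M *m y] gives [1 <= (s - dot y (S *m y)) * K] on the sphere,
   contradicting the choice of [s]; the added 1 keeps [K] positive. *)
exfalso; pose K := specnorm (invmx M) + 1.
have K0 : 0 < K by rewrite ltr_wpDl ?specnorm_ge0.
suff : s <= s - K^-1 by rewrite lerBrDr gerDl leNgt invr_gt0 K0.
apply: ge_sup => // _ [y y1 <-].
have := psd_cauchy_schwarz _ y (invmx M *m y) hM psdM.
rewrite mulKVmx // y1 expr1n MS y1 mulr1 [dot (invmx M *m y) y]dotC.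
have := dot_mulmx_le (invmx M) y; rewrite y1 mulr1 => h1 h2.
have h3 : 0 <= s - dot y (S *m y) by rewrite subr_ge0 -[s]mulr1 -y1.
rewrite lerBrDr -lerBrDl -[leLHS]mul1r ler_pdivrMr //.
apply: le_trans h2 _; rewrite ler_wpM2l //.
by rewrite /K ler_wpDr.
Qed.

Lemma rayleigh_ge {k} (S : 'M[R]_k) c x : S^T = S ->
  (forall a, eigenvalue S a -> c <= a) -> c * dot x x <= dot x (S *m x).
Proof.
move=> hS hc; have := @rayleigh_le k (- S) (- c) x.
rewrite mulNmx dotNr mulNr lerN2; apply; first by rewrite linearN /= hS.
move=> a /eigenvalueP [v hv v0]; rewrite lerNr; apply: hc.
apply/eigenvalueP; exists v => //.
by move: hv; rewrite mulmxN scaleNr => <-; rewrite opprK.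
Qed.

End Norms.

(** * Quality and positivity of the averaged preconditioner *)

Section Preconditioner.
Context {R : realType} {d : nat}.
Implicit Types (H Pc : 'M[R]_d) (e : 'cV[R]_d).

(** The updated error is the inverse defect applied to [r = H *m e], up to sign; [L] enters once
    from the energy of [y] to its norm and once from the norm of [r] to the energy of [e]. *)
Lemma precond_residual_le H Pc L eps e : posdef H -> 0 <= L -> 0 <= eps ->
  (forall x, dot x (H *m x) <= L * dot x x) ->
  (forall x, enorm (Pc *m x - invmx H *m x) <= eps * enorm x) ->
  let y := e - Pc *m (H *m e) in
  dot y (H *m y) <= (L * eps) ^+ 2 * dot e (H *m e).
Proof.
move=> pH L0 eps0 hL heps /=.
have uH := posdef_unit _ pH.
set r := H *m e.
have -> : e - Pc *m r = - (Pc *m r - invmx H *m r) by rewrite opprB mulKmx.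
set y := - _.
have y_r : dot y y <= eps ^+ 2 * dot r r.
  rewrite -!enorm_sqr -exprMn ler_pXn2r ?nnegrE ?mulr_ge0 ?enorm_ge0 //.
  by rewrite enormN.
(* Cauchy-Schwarz in the form of [H] for [e] and [r], then division by [dot r r]. *)
have r_e : dot r r <= L * dot e r.
  have [r0|r0] := eqVneq r 0; first by rewrite r0 !dot0r mulr0.
  have := psd_cauchy_schwarz _ e r pH.1 (fun z => posdef_ge0 _ z pH).
  rewrite (sym_dot H) ?pH.1 // -/r expr2 => h.
  have := le_trans h (ler_wpM2l (posdef_ge0 _ e pH) (hL r)).
  by rewrite -/r mulrA ler_pM2r ?dot_gt0 // mulrC.
apply: le_trans (hL _) _.
have -> : (L * eps) ^+ 2 * dot e r = L * (eps ^+ 2 * (L * dot e r)) by ring.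
apply: ler_wpM2l => //; apply: le_trans y_r _.
by apply: ler_wpM2l => //; rewrite sqr_ge0.
Qed.

Lemma gram_shift_ge {p} (B : 'M[R]_(p, d)) a lam x : 0 <= a ->
  lam * dot x x <= dot x ((a *: (B^T *m B) + lam%:M) *m x).
Proof.
move=> a0; rewrite mulmxDl dotDr dot_scalar -scalemxAl dotZr dot_gram.
by rewrite lerDr mulr_ge0 ?dot_ge0.
Qed.

Lemma gram_shift_sym {p} (B : 'M[R]_(p, d)) a lam :
  (a *: (B^T *m B) + lam%:M)^T = a *: (B^T *m B) + lam%:M.
Proof. by rewrite linearD /= linearZ /= trmx_mul trmxK tr_scalar_mx. Qed.

Lemma gram_shift_posdef {p} (B : 'M[R]_(p, d)) a lam : 0 <= a -> 0 < lam ->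
  posdef (a *: (B^T *m B) + lam%:M).
Proof.
move=> a0 l0; apply: (posdef_lb (gram_shift_sym _ _ _) l0) => x.
exact: gram_shift_ge.
Qed.

Lemma posdef_mean m (B : 'I_m -> 'M[R]_d) : (0 < m)%N ->
  (forall i, posdef (B i)) -> posdef (m%:R^-1 *: \sum_(i < m) B i).
Proof.
move=> m0 pB; split.
  by rewrite linearZ /= raddf_sum; congr (_ *: _); apply: eq_bigr => i _; case: (pB i).
move=> x x0; rewrite -scalemxAl dotZr mulmx_suml dot_sumr.
rewrite mulr_gt0 ?invr_gt0 ?ltr0n //.
rewrite (bigD1 (Ordinal m0)) //= ltr_wpDr ?(pB _).2 //.
by apply: sumr_ge0 => i _; apply: posdef_ge0.
Qed.

Lemma Htilde_inv_posdef n m (A : 'M[R]_(n, d)) lam dl :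
  (0 < m)%N -> 0 < lam -> m%:R * dl < n%:R -> posdef (invmx (Htilde m A lam dl)).
Proof.
move=> m0 l0 hmd; rewrite /Htilde invmxK; apply: posdef_mean => // i.
apply: posdef_inv; apply: gram_shift_posdef => //.
rewrite mulr_ge0 ?divr_ge0 ?ler0n // invr_ge0 subr_ge0.
(* For [n = 0] the quotient is 0 by convention; otherwise [hmd] bounds it by 1. *)
case: n A hmd i => [|n] A hmd i; first by rewrite invr0 mulr0 ler01.
by rewrite ler_pdivrMr ?ltr0n // mul1r ltW.
Qed.

(* With no data, [n%:R^-1 = 0] and the preconditioner is exact. *)
Lemma Htilde_inv_no_data n m (A : 'M[R]_(n, d)) lam dl : (0 < m)%N ->
  n = 0%N -> invmx (Htilde m A lam dl) = invmx (Hmat A lam).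
Proof.
move=> m0 n0; subst n; rewrite /Htilde invmxK /Hmat [in RHS]invr0 scale0r add0r.
have z : m%:R / 0%:R = 0 :> R by rewrite invr0 mulr0.
under eq_bigr do rewrite z mulr0 scale0r add0r.
rewrite sumr_const card_ord -[invmx _ *+ m]scaler_nat scalerA mulVf ?scale1r //.
by rewrite pnatr_eq0 -lt0n.
Qed.

End Preconditioner.

(** * Gradient and minimiser of the ridge objective *)

Section Objective.
Context {R : realType} {n d : nat}.
Variables (A : 'M[R]_(n, d)) (b : 'cV[R]_n) (lam : R).
Implicit Types (x v : 'cV[R]_d).

Definition fgrad x := Hmat A lam *m x - n%:R^-1 *: (A^T *m b).

Lemma dot_Hmat v x : dot v (Hmat A lam *m x) =
  n%:R^-1 * dot (A *m v) (A *m x) + lam * dot v x.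
Proof. by rewrite mulmxDl dotDr dot_scalar -scalemxAl dotZr dot_gram. Qed.

(** The objective is quadratic, so the second-order expansion is exact; both the gradient and the
    optimality condition are read off from it. *)
Lemma fobj_line x v t : fobj A b lam (x + t *: v) =
  fobj A b lam x + t * dot v (fgrad x) + t ^+ 2 * (dot v (Hmat A lam *m v) / 2).
Proof.
have -> : dot v (fgrad x) = dot v (Hmat A lam *m x) - n%:R^-1 * dot (A *m v) b.
  by rewrite /fgrad dotDr dotNr dotZr [dot (A *m v) b]/dot trmx_mul -mulmxA.
rewrite /fobj !enorm_sqr !dot_Hmat.
rewrite mulmxDr -scalemxAr !(dotDl, dotDr, dotNl, dotNr, dotZl, dotZr).
rewrite [dot x v]dotC [dot (A *m x) (A *m v)]dotC [dot b (A *m v)]dotC invfM.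
(* [n] may be 0, so [n%:R^-1] is kept opaque. *)
by move: n%:R^-1 => ninv; field.
Qed.

Lemma gradient_fobj (g : 'cV[R]_d -> 'cV[R]_d) x :
  (forall x v : 'cV[R]_d,
     is_derive (0 : R) (1 : R) (fun t : R => fobj A b lam (x + t *: v))
               (\sum_(j < d) g x j 0 * v j 0)) ->
  g x = fgrad x.
Proof.
move=> hg.
have gv v : dot (g x) v = dot v (fgrad x).
  (* As a polynomial in [t], the restriction to a line has a formal derivative, whose value at 0 is
     the linear coefficient. *)
  pose p : {poly R} := (fobj A b lam x)%:P + (dot v (fgrad x))%:P * 'X
    + (dot v (Hmat A lam *m v) / 2)%:P * 'X^2.
  have pE : (fun t : R => fobj A b lam (x + t *: v)) = horner p.
    apply/funext => t; rewrite fobj_line /p.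
    by rewrite !(hornerD, hornerM, hornerC, hornerX, hornerXn); ring.
  have := hg x v; rewrite pE -dotE => h1.
  have h2 := is_derive_poly p 0.
  rewrite -(@derive_val _ _ _ _ _ _ _ h1) (@derive_val _ _ _ _ _ _ _ h2) /p.
  rewrite !(derivD, derivM, derivC, derivX, derivXn).
  by rewrite !(hornerD, hornerM, hornerC, hornerX, hornerXn, hornerMn); ring.
apply/eqP; rewrite -subr_eq0 -dot_eq0 dotDl dotNl gv [dot (fgrad x) _]dotC.
by rewrite subrr.
Qed.

Lemma argmin_fobj x : 0 < lam ->
  (forall y, fobj A b lam x <= fobj A b lam y) -> fgrad x = 0.
Proof.
move=> l0 hx.
have pH : posdef (Hmat A lam) by apply: gram_shift_posdef; rewrite ?invr_ge0 ?ler0n.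
have uH := posdef_unit _ pH.
pose v := invmx (Hmat A lam) *m fgrad x.
have Hv : Hmat A lam *m v = fgrad x by rewrite mulKVmx.
(* The Newton step lowers the objective by half the energy of [v], so minimality forces [v = 0]. *)
have := hx (x + (-1) *: v); rewrite fobj_line Hv => h.
have v0 : v = 0.
  apply: (posdef_eq0 _ _ pH); apply/eqP; rewrite eq_le posdef_ge0 // andbT Hv.
  by lra.
by rewrite -Hv v0 mulmx0.
Qed.

End Objective.

(** * Positivity of the covariance, and the scalar rate comparison *)

Lemma second_moment_psd (R : realType) (dsp : measure_display)
  (T : measurableType dsp) (P : probability T R) (d : nat)
  (X : 'I_d -> T -> R) (Sigma : 'M[R]_d) :
  (forall j k, P.-integrable setT (fun w => (X j w * X k w)%:E)) ->
  (forall j k, (\int[P]_w (X j w * X k w)%:E = (Sigma j k)%:E)%E) ->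
  Sigma^T = Sigma /\ forall x, 0 <= dot x (Sigma *m x).
Proof.
move=> iX hX; split.
  apply/matrixP => j k; rewrite mxE; apply: EFin_inj; rewrite -!hX.
  by apply: eq_integral => w _; rewrite mulrC.
move=> x; rewrite -lee_fin.
have ix j k : P.-integrable setT (fun w => ((x j 0 * x k 0)%:E * (X j w * X k w)%:E)%E).
  exact: integrableZl.
(* The form is the integral of the square of [\sum_j x j 0 * X j w]. *)
suff -> : ((dot x (Sigma *m x))%:E =
    \int[P]_w (\sum_j \sum_k ((x j 0 * x k 0)%:E * (X j w * X k w)%:E)))%E.
  apply: integral_ge0 => w _.
  under eq_bigr do under eq_bigr do rewrite -EFinM.
  under eq_bigr do rewrite sumEFin.
  rewrite sumEFin lee_fin.
  suff -> : \sum_j \sum_k (x j 0 * x k 0 * (X j w * X k w)) =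
      (\sum_j x j 0 * X j w) ^+ 2 by rewrite sqr_ge0.
  rewrite expr2 big_distrl /=; apply: eq_bigr => j _.
  by rewrite big_distrr /=; apply: eq_bigr => k _; ring.
rewrite integral_sum //; last by move=> j; apply: integrable_sum.
rewrite dotE -sumEFin; apply: eq_bigr => j _.
rewrite integral_sum // mxE mulr_sumr -sumEFin; apply: eq_bigr => k _.
by rewrite integralZl // hX -EFinM; congr EFin; ring.
Qed.

(* After squaring, this amounts to
   [4 * alpha * (1 - alpha) <= (1 + alpha ^+ 2) ^+ 2]. *)
Lemma sqr_le_rate (R : realType) (alpha : R) : 0 <= alpha -> alpha < 1 / 2 ->
  let q := Num.sqrt (1 - alpha / (1 - alpha)) in
  alpha ^+ 2 <= (1 - q) / (1 + q).
Proof.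
move=> a0 a1 /=; set q := Num.sqrt _.
have q0 : 0 <= q by exact: sqrtr_ge0.
have a2 : alpha ^+ 2 <= 1 by rewrite expr_le1 //; lra.
rewrite ler_pdivlMr; last by lra.
(* The map [z |-> (1 - z) / (1 + z)] is a decreasing involution where [1 + z] is positive. *)
suff : q <= (1 - alpha ^+ 2) / (1 + alpha ^+ 2).
  by rewrite ler_pdivlMr ?ltr_pwDl ?sqr_ge0 //; lra.
have d1 : 0 < 1 - alpha by lra.
have d2 : 0 < 1 + alpha ^+ 2 by rewrite ltr_pwDl ?sqr_ge0.
rewrite -[leRHS]ger0_norm; last by rewrite divr_ge0 ?subr_ge0 // ltW.
rewrite -sqrtr_sqr ler_wsqrtr //.
rewrite -subr_ge0.
have -> : ((1 - alpha ^+ 2) / (1 + alpha ^+ 2)) ^+ 2 - (1 - alpha / (1 - alpha)) =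
  alpha * ((1 + alpha ^+ 2) ^+ 2 - 4 * alpha * (1 - alpha))
    / ((1 - alpha) * (1 + alpha ^+ 2) ^+ 2).
  by field; rewrite !gt_eqF.
apply: divr_ge0; last by rewrite mulr_ge0 ?sqr_ge0 // ltW.
apply: mulr_ge0 => //.
(* The bracket equals [(1 - 2 * alpha) ^+ 2 + 2 * alpha ^+ 2 + alpha ^+ 4]. *)
have := sqr_ge0 (1 - 2 * alpha); have := sqr_ge0 (alpha ^+ 2).
have := sqr_ge0 alpha; lra.
Qed.

(** * Assembly of the error bound for one outer iteration *)

Theorem theorem3p2
  (R : realType) (dsp : measure_display) (T : measurableType dsp)
  (P : probability T R) (n d m : nat)
  (Arand : T -> 'M[R]_(n, d)) (b : 'cV[R]_n) (lam : R)
  (Sigma : 'M[R]_d) (EHinv : 'M[R]_d) (smin smax : R) :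
  (* rows of A are i.i.d., mean zero, covariance Sigma *)
  iid_rows P Arand ->
  (forall i j, P.-integrable setT (fun w => (Arand w i j)%:E)) ->
  (forall i j, (\int[P]_w (Arand w i j)%:E = 0)%E) ->
  (forall i j k, P.-integrable setT (fun w => (Arand w i j * Arand w i k)%:E)) ->
  (forall i j k, (\int[P]_w (Arand w i j * Arand w i k)%:E = (Sigma j k)%:E)%E) ->
  (* smin, smax are the extreme eigenvalues of Sigma *)
  eigenvalue Sigma smin -> eigenvalue Sigma smax ->
  (forall a, eigenvalue Sigma a -> smin <= a <= smax) ->
  (* A is split row-wise into m blocks of n/m rows *)
  (0 < m)%N -> (m %| n)%N ->
  0 < lam ->
  m%:R * dlam Sigma lam < n%:R ->
  (* EHinv = E[Htilde^-1] (entrywise expectation) *)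
  (forall j k, P.-integrable setT
     (fun w => (invmx (Htilde m (Arand w) lam (dlam Sigma lam)) j k)%:E)) ->
  (forall j k, (\int[P]_w (invmx (Htilde m (Arand w) lam (dlam Sigma lam)) j k)%:E
                 = (EHinv j k)%:E)%E) ->
  forall w : T,
  let A := Arand w in
  let H := Hmat A lam in
  let Ht := Htilde m A lam (dlam Sigma lam) in
  let alpha0 := specnorm (Sigma - n%:R^-1 *: (A^T *m A)) in
  let alpha1 := specnorm (invmx Ht - EHinv) in
  let Omega0 := EHinv - invmx (Sigma + lam%:M) in
  let alpha := (smax + lam + alpha0) * (alpha0 / lam ^+ 2 + alpha1 + specnorm Omega0) in
  let q := Num.sqrt (1 - alpha / (1 - alpha)) in
  forall (g : 'cV[R]_d -> 'cV[R]_d),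
  (* g is the gradient of f *)
  (forall x v : 'cV[R]_d,
     is_derive (0 : R) (1 : R) (fun t : R => fobj A b lam (x + t *: v))
               (\sum_(j < d) g x j 0 * v j 0)) ->
  forall (ostar : 'cV[R]_d),
  (forall x, fobj A b lam ostar <= fobj A b lam x) ->
  forall (omega : nat -> 'cV[R]_d) (s : nat -> nat),
  (forall t, omega t.+1 = omega t - pcg H (invmx Ht) (g (omega t)) (s t)) ->
  forall t : nat,
  let alpha' := Num.sqrt (4 * ((1 - q) / (1 + q)) ^+ s t) in
  (* conditions under which the right-hand side is well defined *)
  alpha < 1 / 2 -> alpha' < 1 -> alpha0 < smin + lam ->
  enorm (omega t.+1 - ostar) <=
    Num.sqrt 2 * alpha' / Num.sqrt (1 - alpha' ^+ 2)
    * Num.sqrt ((smax + lam + alpha0) / (smin + lam - alpha0))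
    * enorm (omega t - ostar).
Proof.
move=> _ _ _ iA hA esmin esmax hs m0 _ l0 hmd _ _ w A H Ht alpha0 alpha1 Omega0
  alpha q g hg ostar hostar omega s homega t alpha' a_half ap1 a0_lt.
have pH : posdef H by apply: gram_shift_posdef; rewrite ?invr_ge0 ?ler0n.
have pPc : posdef (invmx Ht) by exact: Htilde_inv_posdef.
set u := omega t - ostar.
(* The gradient vanishes at [ostar], so the inner system has solution [u] and the new outer error is
   the inner solver's error. *)
have gu : g (omega t) = H *m u.
  rewrite (gradient_fobj _ _ _ _ _ hg) -[LHS]subr0.
  rewrite -(argmin_fobj _ _ _ _ l0 hostar) /fgrad.
  by rewrite opprB addrA subrK -mulmxBr.
have -> : omega t.+1 - ostar = u - pcg H (invmx Ht) (H *m u) (s t).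
  by rewrite homega gu addrAC.
set e := u - _.
(* Zero inner iterations would make [alpha'] equal to 2. *)
have s_gt0 : (0 < s t)%N.
  rewrite lt0n; apply: contraTneq ap1 => s0.
  rewrite /alpha' s0 expr0 mulr1 -leNgt.
  by rewrite -[leLHS]sqrtr1 ler_wsqrtr // ler1n.
have rhs_ge0 : 0 <= Num.sqrt 2 * alpha' / Num.sqrt (1 - alpha' ^+ 2)
    * Num.sqrt ((smax + lam + alpha0) / (smin + lam - alpha0)).
  by rewrite !(mulr_ge0, invr_ge0, sqrtr_ge0).
(* With no rows, there is no row from which to derive the symmetry of [Sigma]; but then the
   contraction factor is 0, and a positive number of steps gives [e = 0]. *)
case: (posnP n) => [n0|n0].
  have PcE : invmx Ht = invmx H by exact: Htilde_inv_no_data.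
  have uH := posdef_unit _ pH.
  have : dot e (H *m e) <= 0 ^+ s t * dot u (H *m u).
    apply: pcg_contraction => // z.
    by rewrite /= PcE mulKmx // subrr mul0r dot0l.
  rewrite expr0n gtn_eqF // mul0r => he.
  have -> : e = 0.
    by apply: (posdef_eq0 _ _ pH); apply/eqP; rewrite eq_le he posdef_ge0.
  by rewrite enorm0 mulr_ge0 ?enorm_ge0.
have [symS psdS] : Sigma^T = Sigma /\ forall x, 0 <= dot x (Sigma *m x).
  apply: (second_moment_psd _ _ _ P _ (fun j w => Arand w (Ordinal n0) j)) => j k.
    exact: iA.
  exact: hA.
have a0_ge0 : 0 <= alpha0 by exact: specnorm_ge0.
pose G := n%:R^-1 *: (A^T *m A).
have hG : specnorm (Sigma - G) = alpha0 by [].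
have symH := pH.1.
(* Viewing [H] as a perturbation of [Sigma + lam%:M] of norm [alpha0] bounds its form between [mu]
   and [L]. *)
have HE x : dot x (H *m x) =
    dot x (Sigma *m x) + lam * dot x x - dot x ((Sigma - G) *m x).
  rewrite -dot_scalar -dotDr -mulmxDl -dotNr -mulNmx -dotDr -mulmxDl.
  by congr (dot x (_ *m x)); rewrite opprB [Sigma + _]addrC -addrA [RHS]addrC subrKC.
have H_le x : dot x (H *m x) <= (smax + lam + alpha0) * dot x x.
  have := rayleigh_le Sigma smax x symS (fun a ha => proj2 (andP (hs a ha))).
  have := dot_mulmx_ge (Sigma - G) x; rewrite HE hG; lra.
have H_ge x : (smin + lam - alpha0) * dot x x <= dot x (H *m x).
  have := rayleigh_ge Sigma smin x symS (fun a ha => proj1 (andP (hs a ha))).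
  have := dot_mulmx_le (Sigma - G) x; rewrite HE hG; lra.
have /andP [smin_max _] := hs _ esmax.
have mu0 : 0 < smin + lam - alpha0 by lra.
have L0 : 0 < smax + lam + alpha0 by lra.
set L := smax + lam + alpha0 in alpha q alpha' a_half ap1 L0 H_le rhs_ge0 *.
set mu := smin + lam - alpha0 in mu0 H_ge rhs_ge0 *.
pose eps := alpha0 / lam ^+ 2 + alpha1 + specnorm Omega0.
have eps0 : 0 <= eps.
  by rewrite !addr_ge0 ?specnorm_ge0 // divr_ge0 // sqr_ge0.
have inv_close x : enorm (invmx Ht *m x - invmx H *m x) <= eps * enorm x.
  have symSl : (Sigma + lam%:M)^T = Sigma + lam%:M.
    by rewrite linearD /= tr_scalar_mx symS.
  have Sl_ge z : lam * dot z z <= dot z ((Sigma + lam%:M) *m z).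
    by rewrite mulmxDl dotDr dot_scalar lerDr.
  have Hl_ge z : lam * dot z z <= dot z (H *m z).
    by apply: gram_shift_ge; rewrite invr_ge0 ler0n.
  have := enorm_invmxB H (Sigma + lam%:M) lam x l0 symH symSl Hl_ge Sl_ge.
  have -> : Sigma + lam%:M - H = Sigma - G.
    by rewrite /H /Hmat opprD addrACA -/G subrr addr0.
  rewrite hG => h1.
  have h2 := enorm_mulmx (invmx Ht - EHinv) x.
  have h3 := enorm_mulmx Omega0 x.
  (* The three terms are the fluctuation, the bias and the sampling error; their norms give the
     summands of [eps]. *)
  have -> : invmx Ht *m x - invmx H *m x =
      (invmx Ht - EHinv) *m x + Omega0 *m x
      - (invmx H *m x - invmx (Sigma + lam%:M) *m x).
    rewrite /Omega0 !mulmxBl opprB !addrA subrK.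
    by rewrite addrAC [RHS]addrAC; congr (_ - _); rewrite subrK.
  apply: le_trans (enormD _ _) _; rewrite enormN.
  have h4 := enormD ((invmx Ht - EHinv) *m x) (Omega0 *m x).
  rewrite /eps /alpha1; lra.
have alpha_ge0 : 0 <= alpha by rewrite mulr_ge0 // ltW.
have he : dot e (H *m e) <= (alpha ^+ 2) ^+ s t * dot u (H *m u).
  apply: pcg_contraction => //; first exact: sqr_ge0.
  move=> z; apply: precond_residual_le => //; exact: ltW.
have q0 : 0 <= q by exact: sqrtr_ge0.
(* The factor 4 inside [alpha'] is slack here. *)
have rate_le : (alpha ^+ 2) ^+ s t <= alpha' ^+ 2.
  have rate0 : alpha ^+ 2 <= (1 - q) / (1 + q) by exact: sqr_le_rate.
  have rate1 : 0 <= (1 - q) / (1 + q) by apply: le_trans rate0; exact: sqr_ge0.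
  rewrite sqr_sqrtr ?mulr_ge0 ?exprn_ge0 //.
  apply: le_trans (_ : ((1 - q) / (1 + q)) ^+ s t <= _).
    by rewrite lerXn2r ?nnegrE ?sqr_ge0.
  by rewrite ler_peMl ?exprn_ge0 // ler1n.
have ap0 : 0 <= alpha' by exact: sqrtr_ge0.
clearbody alpha'.
have ap2 : 0 < 1 - alpha' ^+ 2 by rewrite subr_gt0 expr_lt1.
apply: enorm_le => //.
have -> : (Num.sqrt 2 * alpha' / Num.sqrt (1 - alpha' ^+ 2) * Num.sqrt (L / mu)) ^+ 2
    = 2 / (1 - alpha' ^+ 2) * (alpha' ^+ 2 * L) / mu.
  rewrite !exprMn exprVn !sqr_sqrtr ?divr_ge0 ?ler0n ?(ltW ap2) ?(ltW L0) ?(ltW mu0) //.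
  by ring.
have he_mu : mu * dot e e <= alpha' ^+ 2 * L * dot u u.
  apply: le_trans (H_ge e) _; apply: le_trans he _.
  rewrite -mulrA; apply: le_trans (ler_wpM2l (sqr_ge0 _) (H_le u)).
  by rewrite ler_wpM2r // posdef_ge0.
have B0 : 0 <= alpha' ^+ 2 * L * dot u u.
  by rewrite !mulr_ge0 ?sqr_ge0 ?dot_ge0 // ltW.
rewrite mulrAC ler_pdivlMr // mulrC; apply: le_trans he_mu _.
(* The remaining factor [2 / (1 - alpha' ^+ 2)] is at least 1. *)
rewrite -[X in _ <= X]mulrA ler_peMl // ler_pdivlMr // mul1r.
by have := sqr_ge0 alpha'; lra.
Qed.
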